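(* Let $p$ be a prime number, let $V$ be a commutative ring, let $\varpi \in V$ be a regular element (nonzerodivisor) with a compatible system of $p$-power roots $\{\varpi^{1/p^n}\}_{n\ge 0}$ in $V$, and let $I=\bigcup_{n>0}(\varpi^{1/p^n})$, so that $(V,I)$ is a basic setup. Let $M$ be an $I$-almost finitely generated $V$-module such that $M/\varpi^nM$ is an $I$-almost projective $V/\varpi^nV$-module for every integer $n>0$. Suppose that $M$ and $V$ are $\varpi$-adically complete. Then $M$ is an $I$-almost projective $V$-module.
   Context: A basic setup $(V,I)$ is a commutative ring $V$ with an ideal $I$ such that $I^2=I$ and $I\otimes_V I$ is flat over $V$. A compatible system of $p$-power roots means $\varpi^{1/p^0}=\varpi$ and $(\varpi^{1/p^{n+1}})^p=\varpi^{1/p^n}$ for all $n \geq 0$. Let $R$ be a $V$-algebra and $M$ an $R$-module. - $M$ is $I$-almost zero, written $M\approx 0$, if $IM=0$. - $M$ is an $I$-almost finitely generated $R$-module if for every finitely generated ideal $I_0\subseteq I$ there exist a finitely generated $R$-module $M_0$ and an $R$-linear map $f_0:M_0\to M$ whose kernel and cokernel are annihilated by $I_0$. - $M$ is an $I$-almost projective $R$-module if $\mathrm{Ext}^i_R(M,N)\approx 0$ for every $R$-module $N$ and every $i>0$. $M$ is $\varpi$-adically complete if the natural map $M\to\varprojlim_n M/\varpi^nM$ is an isomorphism. *)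

(* Defs.v *)
From HB Require Import structures.
From mathcomp Require Import all_boot all_algebra finmap all_classical.

Set Implicit Arguments.
Unset Strict Implicit.
Unset Printing Implicit Defensive.

Import GRing.Theory.
Local Open Scope ring_scope.
Local Open Scope quotient_scope.
Local Open Scope classical_set_scope.

Section Submodules.
Variables (R : pzRingType) (M : lmodType R).

Section Sub.
Variable S : submodClosed M.

Definition submodule := {x : M | x \in (S : {pred M})}.
HB.instance Definition _ := [isSub of submodule for @sval _ _].
HB.instance Definition _ := [Choice of submodule by <:].
HB.instance Definition _ := [SubChoice_isSubLmodule of submodule by <:].
End Sub.

Section Quot.
Variable S : submodClosed M.

(* The library quotient wants a [zmodClosed], which [submodClosed] does not
   provide by itself. *)
Definition zclosed_of : {pred M} := S.
Lemma zclosed_of_closed : GRing.zmod_closed zclosed_of.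
Proof. exact: GRing.submod_closedB (submodClosedP S). Qed.
HB.instance Definition _ :=
  GRing.isZmodClosed.Build M zclosed_of zclosed_of_closed.

Definition quotmod := Quotient.quot (zclosed_of : zmodClosed M).
HB.instance Definition _ := GRing.Zmodule.on quotmod.
HB.instance Definition _ := EqQuotient.on quotmod.

Definition to_quot (x : M) : quotmod := \pi_quotmod x.

Lemma to_quotP x y : reflect (to_quot x = to_quot y) (x - y \in S).
Proof.
rewrite -[_ \in _]/((x - y) \in (zclosed_of : zmodClosed M)).
by rewrite Quotient.idealrBE; exact: eqP.
Qed.

Definition quotmod_scale (a : R) (q : quotmod) : quotmod :=
  to_quot (a *: repr q).

Lemma quotmod_scaleE a x : quotmod_scale a (to_quot x) = to_quot (a *: x).
Proof.
apply/to_quotP; rewrite -scalerBr rpredZ //; apply/to_quotP.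
by rewrite /to_quot reprK.
Qed.

Lemma to_quotD x y : to_quot (x + y) = to_quot x + to_quot y.
Proof. by rewrite /to_quot piE. Qed.

Lemma to_quotK q : to_quot (repr q) = q. Proof. exact: reprK. Qed.

Fact quotmod_scaleA a b q :
  quotmod_scale a (quotmod_scale b q) = quotmod_scale (a * b) q.
Proof. by rewrite -[q]to_quotK !quotmod_scaleE scalerA. Qed.
Fact quotmod_scale1 : left_id 1 quotmod_scale.
Proof. by move=> q; rewrite -[q]to_quotK quotmod_scaleE scale1r. Qed.
Fact quotmod_scaleDr : right_distributive quotmod_scale +%R.
Proof.
move=> a p q; rewrite -[q]to_quotK -[p]to_quotK -to_quotD !quotmod_scaleE.
by rewrite scalerDr to_quotD.
Qed.
Fact quotmod_scaleDl q : {morph quotmod_scale^~ q : a b / a + b}.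
Proof.
by move=> a b; rewrite -[q]to_quotK !quotmod_scaleE scalerDl to_quotD.
Qed.
HB.instance Definition _ := GRing.Zmodule_isLmodule.Build R quotmod
  quotmod_scaleA quotmod_scale1 quotmod_scaleDr quotmod_scaleDl.

Fact to_quot_linear : linear to_quot.
Proof. by move=> a x y; rewrite to_quotD -quotmod_scaleE. Qed.
HB.instance Definition _ :=
  GRing.isLinear.Build R M quotmod *:%R to_quot to_quot_linear.
End Quot.
End Submodules.

Section LinearMaps.
Variables (R : pzRingType) (U V : lmodType R) (f : {linear U -> V}).

Definition ker_pred : {pred U} := fun x => f x == 0.
Fact ker_closed : GRing.submod_closed ker_pred.
Proof.
split; rewrite /ker_pred ?unfold_in ?linear0 // => a x y.
by rewrite !unfold_in linearP => /eqP -> /eqP ->; rewrite scaler0 addr0.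
Qed.
HB.instance Definition _ := GRing.isSubmodClosed.Build R U ker_pred ker_closed.

Definition im_pred : {pred V} := fun y => `[< exists x, y = f x >].
Fact im_closed : GRing.submod_closed im_pred.
Proof.
split; rewrite /im_pred ?unfold_in; first by apply/asboolP; exists 0; rewrite linear0.
move=> a _ _ /asboolP[x ->] /asboolP[y ->].
by apply/asboolP; exists (a *: x + y); rewrite linearP.
Qed.
HB.instance Definition _ := GRing.isSubmodClosed.Build R V im_pred im_closed.

Definition ker_mod : lmodType R := submodule ker_pred.
Definition coker_mod : lmodType R := quotmod im_pred.

Lemma ker_val0 (z : ker_mod) : f (val z) = 0.
Proof. by apply/eqP; exact: (valP z). Qed.
End LinearMaps.

Section FreeModule.
Variables (R : pzRingType).

Definition fin_supp (X : Type) : {pred (X -> R^o)} :=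
  fun c => `[< finite_set [set x | c x != 0] >].
Fact fin_supp_closed X : GRing.submod_closed (@fin_supp X).
Proof.
split; rewrite /fin_supp ?unfold_in.
  apply/asboolP; rewrite (_ : [set _ | _] = set0) //.
  by apply/seteqP; split=> x //=; rewrite eqxx.
move=> a u v /asboolP hu /asboolP hv; apply/asboolP.
apply: (@sub_finite_set _ _ ([set x | u x != 0] `|` [set x | v x != 0])).
  move=> x /=; rewrite -[(a *: u + v) x]/(a * u x + v x).
  case: (eqVneq (u x) 0) => [->|]; last by left.
  by rewrite mulr0 add0r; right.
by rewrite finite_setU.
Qed.
HB.instance Definition _ X :=
  GRing.isSubmodClosed.Build R (X -> R^o) (@fin_supp X) (@fin_supp_closed X).

(* The free module on X: finitely supported coefficient functions. *)
Definition free_module (X : Type) : lmodType R := submodule (@fin_supp X).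

(* The surjection R[M] -> M sending the basis element [x] to x; the sum ranges
   over the finite support of its general term. *)
Definition counit (M : lmodType R) (c : free_module M) : M :=
  \sum_(x \in [set: M]) (val c x : R) *: (x : M).
Lemma counitE (M : lmodType R) (D : set M) (c : free_module M) :
    finite_set D -> [set x | val c x != 0] `<=` D ->
  counit c = \sum_(x <- fset_set D) (val c x : R) *: (x : M).
Proof.
move=> finD suppD; rewrite -fsbig_finite // /counit.
apply/esym/fsbig_widen => // x [_ /= xD]; have [->|cx] := eqVneq (val c x) 0.
  by rewrite scale0r.
by case: xD; apply: suppD.
Qed.

Fact counit_linear M : linear (@counit M).
Proof.
move=> a u v.
have fin (c : free_module M) : finite_set [set x | val c x != 0].
  by have /asboolP := valP c.
set D := [set x | val u x != 0] `|` [set x | val v x != 0].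
have finD : finite_set D by rewrite finite_setU.
rewrite !(counitE finD); last 3 first.
- by move=> x; right.
- by move=> x; left.
- move=> x /=; apply: contraNP => /not_orP[/negP/negPn/eqP ux /negP/negPn/eqP vx].
  by rewrite -[(_ + _) x]/(a * val u x + val v x) ux vx mulr0 addr0.
rewrite scaler_sumr -big_split /=; apply: eq_bigr => x _.
by rewrite scalerA -scalerDl.
Qed.
HB.instance Definition _ (M : lmodType R) :=
  GRing.isLinear.Build R (free_module M) M *:%R (@counit M) (@counit_linear M).

(* Canonical free resolution: F_n = R[Z_n] with Z_0 = M and
   Z_{n+1} = ker (R[Z_n] -> Z_n); the differential is the composite
   F_{n+1} -> Z_{n+1} -> F_n. *)
Fixpoint syzygy (M : lmodType R) (n : nat) : lmodType R :=
  if n is n'.+1 then ker_mod (@counit (syzygy M n')) else M.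

Definition resolution (M : lmodType R) n := free_module (syzygy M n).

Definition resolution_diff (M : lmodType R) n
    : resolution M n.+1 -> resolution M n :=
  fun c => \val (counit c : ker_mod (@counit (syzygy M n))).
Fact resolution_diff_linear M n : linear (@resolution_diff M n).
Proof. by move=> a u v; rewrite /resolution_diff linearP. Qed.
HB.instance Definition _ (M : lmodType R) n := GRing.isLinear.Build R _ _ *:%R
  (@resolution_diff M n) (@resolution_diff_linear M n).

Let counit_counit (X : lmodType R) (c : ker_mod (@counit (ker_mod (@counit X)))) :
  val (counit (val c)) = 0.
Proof.
have h := @ker_val0 R _ _ (@counit (ker_mod (@counit X))) c.
rewrite h.
reflexivity.
Qed.

Lemma resolution_diff_comp (M : lmodType R) n c :
  @resolution_diff M n (@resolution_diff M n.+1 c) = 0.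
Proof. exact: (@counit_counit (syzygy M n) (counit c)). Qed.
End FreeModule.

Section Ext.
Variable R : comPzRingType.

Section hom_mod.
Variables U V : lmodType R.
Definition linear_pred : {pred (U -> V)} := fun f => `[< linear f >].
Fact linear_pred_closed : GRing.submod_closed linear_pred.
Proof.
split; rewrite /linear_pred ?unfold_in.
  by apply/asboolP => a x y; rewrite /= scaler0 addr0.
move=> b f g /asboolP hf /asboolP hg; apply/asboolP => a x y.
rewrite -[LHS]/(b *: f _ + g _) -[in RHS]/(b *: f _ + g _) hf hg.
rewrite -[(b *: f + g) y]/(b *: f y + g y).
by rewrite !scalerDr !scalerA addrACA [b * a]mulrC.
Qed.
HB.instance Definition _ :=
  GRing.isSubmodClosed.Build R (U -> V) linear_pred linear_pred_closed.
Definition hom_mod : lmodType R := submodule linear_pred.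
End hom_mod.

Section Precomp.
Variables (U U' N : lmodType R) (d : {linear U' -> U}).
Fact precomp_subproof (f : hom_mod U N) : (val f \o d) \in @linear_pred U' N.
Proof.
have /asboolP hf := valP f.
by apply/asboolP => a x y /=; rewrite linearP hf.
Qed.
Definition precomp (f : hom_mod U N) : hom_mod U' N :=
  exist (fun g => g \in @linear_pred U' N) (val f \o d) (precomp_subproof f).
Fact precomp_linear : linear precomp.
Proof. by move=> a f g; apply: val_inj. Qed.
HB.instance Definition _ :=
  GRing.isLinear.Build R (hom_mod U N) (hom_mod U' N) *:%R precomp precomp_linear.
End Precomp.

Section Homology.
Variables (A B C : lmodType R) (d : {linear A -> B}) (e : {linear B -> C}).
Definition boundary_pred : {pred (ker_mod e)} := fun z => \val z \in im_pred d.
Fact boundary_closed : GRing.submod_closed boundary_pred.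
Proof.
have [i0 iP] := submodClosedP (im_pred d : submodClosed B).
split; first by rewrite /boundary_pred unfold_in linear0.
by move=> a x y hx hy; rewrite /boundary_pred unfold_in linearP; apply: iP.
Qed.
HB.instance Definition _ :=
  GRing.isSubmodClosed.Build R (ker_mod e) boundary_pred boundary_closed.
(* ker e / (im d `&` ker e), that is, ker e / im d whenever e \o d = 0. *)
Definition homology : lmodType R := quotmod boundary_pred.
End Homology.

Definition ext_diff (M N : lmodType R) n :
    {linear hom_mod (resolution M n) N -> hom_mod (resolution M n.+1) N} :=
  precomp (N := N) (@resolution_diff R M n).

(* Ext^i_R(M, N) is the i-th cohomology of Hom_R(F_*, N). *)
Definition Ext (i : nat) (M N : lmodType R) : lmodType R :=
  if i is j.+1 then homology (ext_diff M N j) (ext_diff M N j.+1)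
  else homology (\0 : {linear hom_mod (resolution M 0) N -> _}) (ext_diff M N 0).
End Ext.

Section Reduction.
Variables (R : comPzRingType) (x : R).

Definition scale_by (M : lmodType R) (m : M) : M := x *: m.
Fact scale_by_linear M : linear (@scale_by M).
Proof. by move=> a u v; rewrite /scale_by scalerDr !scalerA mulrC. Qed.
HB.instance Definition _ (M : lmodType R) :=
  GRing.isLinear.Build R M M *:%R (@scale_by M) (@scale_by_linear M).

Lemma im_scaleP (M : lmodType R) (m : M) :
  reflect (exists m', m = x *: m') (m \in im_pred (@scale_by M)).
Proof. exact: asboolP. Qed.

(* R / xR.  The library's ring quotient is restricted to proper ideals; here x
   may be a unit. *)
Definition red_ring := quotmod (im_pred (@scale_by R^o)).
HB.instance Definition _ := GRing.Zmodule.on red_ring.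
Definition to_red_ring (a : R) : red_ring :=
  to_quot (im_pred (@scale_by R^o)) a.

Definition red_ring_mul (p q : red_ring) : red_ring :=
  to_red_ring ((repr p : R) * (repr q : R)).

Let kerP (a b : R) : to_red_ring a = to_red_ring b <-> exists c, a - b = x * c.
Proof.
split.
  by move/to_quotP/im_scaleP.
by move=> h; apply/to_quotP/im_scaleP.
Qed.

Lemma to_red_ringK (p : red_ring) : to_red_ring (repr p) = p.
Proof. exact: to_quotK. Qed.

Lemma red_ring_mulE a b :
  red_ring_mul (to_red_ring a) (to_red_ring b) = to_red_ring (a * b).
Proof.
have [c cE] := (kerP _ _).1 (to_red_ringK (to_red_ring a)).
have [d dE] := (kerP _ _).1 (to_red_ringK (to_red_ring b)).
apply/kerP; set a' : R := repr _ in cE *; set b' : R := repr _ in dE *.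
exists (c * b' + a * d).
rewrite mulrDr mulrA -cE mulrCA -dE mulrBl mulrBr.
by rewrite addrA subrK.
Qed.

Lemma to_red_ringD a b :
  to_red_ring (a + b) = to_red_ring a + to_red_ring b.
Proof. exact: to_quotD. Qed.

Fact red_ring_mulA : associative red_ring_mul.
Proof.
move=> p q r; rewrite -[p]to_red_ringK -[q]to_red_ringK -[r]to_red_ringK.
by rewrite !red_ring_mulE mulrA.
Qed.
Fact red_ring_mulC : commutative red_ring_mul.
Proof. by move=> p q; rewrite /red_ring_mul mulrC. Qed.
Fact red_ring_mul1 : left_id (to_red_ring 1) red_ring_mul.
Proof. by move=> p; rewrite -[p]to_red_ringK red_ring_mulE mul1r. Qed.
Fact red_ring_mulD : left_distributive red_ring_mul +%R.
Proof.
move=> p q r; rewrite -[p]to_red_ringK -[q]to_red_ringK -[r]to_red_ringK.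
by rewrite -to_red_ringD !red_ring_mulE mulrDl to_red_ringD.
Qed.
HB.instance Definition _ := GRing.Zmodule_isComPzRing.Build red_ring
  red_ring_mulA red_ring_mulC red_ring_mul1 red_ring_mulD.

Fact to_red_ring_zmod : zmod_morphism to_red_ring.
Proof. by move=> a b; rewrite /to_red_ring linearB. Qed.
Fact to_red_ring_monoid : monoid_morphism to_red_ring.
Proof. by split=> // a b; rewrite -red_ring_mulE. Qed.
HB.instance Definition _ :=
  GRing.isZmodMorphism.Build R red_ring to_red_ring to_red_ring_zmod.
HB.instance Definition _ :=
  GRing.isMonoidMorphism.Build R red_ring to_red_ring to_red_ring_monoid.

Section RedMod.
Variable M : lmodType R.
(* M / xM as an (R / xR)-module; as an R-module it is [coker_mod (scale_by x)]. *)
Definition red_mod := quotmod (im_pred (@scale_by M)).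
HB.instance Definition _ := GRing.Zmodule.on red_mod.
Definition to_red_mod (m : M) : red_mod := to_quot (im_pred (@scale_by M)) m.

Definition red_mod_scale (p : red_ring) (q : red_mod) : red_mod :=
  to_red_mod ((repr p : R) *: (repr q : M)).

Lemma to_red_modK (q : red_mod) : to_red_mod (repr q) = q.
Proof. exact: to_quotK. Qed.
Lemma to_red_modD m n : to_red_mod (m + n) = to_red_mod m + to_red_mod n.
Proof. exact: to_quotD. Qed.

Lemma red_mod_scaleE a m :
  red_mod_scale (to_red_ring a) (to_red_mod m) = to_red_mod (a *: m).
Proof.
have [c cE] := (kerP _ _).1 (to_red_ringK (to_red_ring a)).
have /to_quotP/im_scaleP[d dE] := to_red_modK (to_red_mod m).
apply/to_quotP/im_scaleP; set a' : R := repr _ in cE *.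
set m' : M := repr _ in dE *.
exists (c *: m' + a *: d).
rewrite scalerDr !scalerA -cE [x * a]mulrC -scalerA -dE scalerBl scalerBr.
by rewrite addrA subrK.
Qed.

Fact red_mod_scaleA p q m :
  red_mod_scale p (red_mod_scale q m) = red_mod_scale (p * q) m.
Proof.
rewrite -[m]to_red_modK -[p]to_red_ringK -[q]to_red_ringK -rmorphM.
by rewrite !red_mod_scaleE scalerA.
Qed.
Fact red_mod_scale1 : left_id 1 red_mod_scale.
Proof.
by move=> m; rewrite -[m]to_red_modK -(rmorph1 to_red_ring) red_mod_scaleE scale1r.
Qed.
Fact red_mod_scaleDr : right_distributive red_mod_scale +%R.
Proof.
move=> p m n; rewrite -[m]to_red_modK -[n]to_red_modK -[p]to_red_ringK.
by rewrite -to_red_modD !red_mod_scaleE scalerDr to_red_modD.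
Qed.
Fact red_mod_scaleDl m : {morph red_mod_scale^~ m : p q / p + q}.
Proof.
move=> p q; rewrite -[m]to_red_modK -[p]to_red_ringK -[q]to_red_ringK -rmorphD.
by rewrite !red_mod_scaleE scalerDl to_red_modD.
Qed.
HB.instance Definition _ := GRing.Zmodule_isLmodule.Build red_ring red_mod
  red_mod_scaleA red_mod_scale1 red_mod_scaleDr red_mod_scaleDl.
End RedMod.
End Reduction.

Section Completeness.
Variables (R : comPzRingType) (x : R) (M : lmodType R).

Definition adic_quot (n : nat) : lmodType R := coker_mod (@scale_by R (x ^+ n) M).

Definition adic_proj n (m : M) : adic_quot n := to_quot _ m.

Definition adic_trans n (q : adic_quot n.+1) : adic_quot n :=
  adic_proj n (repr q).

Lemma adic_transE n m : adic_trans (adic_proj n.+1 m) = adic_proj n m.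
Proof.
apply/to_quotP/im_scaleP.
have /to_quotP/im_scaleP[d dE] := to_quotK (adic_proj n.+1 m).
by exists (x *: d); rewrite scalerA -exprSr -dE.
Qed.

(* The inverse limit of the M / x^n M. *)
Definition adic_completion :=
  {q : forall n, adic_quot n | forall n, adic_trans (q n.+1) = q n}.

Definition to_completion (m : M) : adic_completion :=
  exist (fun q : forall n, adic_quot n => forall n, adic_trans (q n.+1) = q n)
    (fun n => adic_proj n m) (fun n => adic_transE n m).

Definition adically_complete := bijective to_completion.
End Completeness.

Section LinearSpan.
Variables (R : pzRingType) (M : lmodType R).

Definition lin_span n (g : 'I_n -> M) : set M :=
  [set m | exists c : 'I_n -> R, m = \sum_i c i *: g i].

Definition fin_gen := exists n (g : 'I_n -> M), lin_span g = [set: M].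
End LinearSpan.

(* R is a V-algebra through phi. *)
Section Almost.
Variables (V R : comPzRingType) (phi : {rmorphism V -> R}).
Implicit Types (I : set V) (M : lmodType R).

Definition almost_zero I M := forall a (m : M), I a -> phi a *: m = 0.

Definition almost_fin_gen I M :=
  forall n (g : 'I_n -> V^o), let I0 := lin_span g : set V in I0 `<=` I ->
  exists (M0 : lmodType R) (f0 : {linear M0 -> M}),
    [/\ fin_gen M0, almost_zero I0 (ker_mod f0) & almost_zero I0 (coker_mod f0)].

Definition almost_projective I M :=
  forall (N : lmodType R) (i : nat), (0 < i)%N -> almost_zero I (Ext i M N).
End Almost.

Definition principal (V : comPzRingType) (a : V) : set V :=
  [set b | exists c, b = c * a].

(* Main.v *)
Require Import Defs.
From HB Require Import structures.
From mathcomp Require Import all_boot all_algebra finmap all_classical.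
From mathcomp Require Import zify.

Set Implicit Arguments.
Unset Strict Implicit.
Unset Printing Implicit Defensive.

Import GRing.Theory.
Local Open Scope ring_scope.
Local Open Scope classical_set_scope.

(** Call a linear map s : N -> R[N] into the free module on N an a-section if
composing it with the canonical surjection R[N] -> N gives multiplication by a.
An a-section of N exists as soon as a kills Ext^1(N, Z), Z being the kernel of
R[N] -> N; conversely it yields an a-section of each syzygy of N, and hence a
kills every Ext^i(N, -) with i > 0 ([ext1_section], [section_ext]).  Thus both
the hypothesis and the conclusion are about sections, and it is enough to find
an a-section of M for every a = varpi^(1/p^k).

Let e = varpi^(1/p^K) with K large.  Almost finite generation gives a linear map
f : V^m -> M whose cokernel is killed by e.  Almost projectivity of M/varpi^n
gives a map g : M -> V^m, linear modulo varpi^n, such that f g = e^2 modulo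
varpi^n.  Each further lift, from modulo varpi^j to modulo varpi^(j+1), costs a
factor in I.  These factors can be chosen to be consecutive quotients of the
roots varpi^(1/p^(K+j)), so that their product telescopes: e g lifts all the way
to a linear map G : M -> V^m, because V is complete ([lift_limit]).  Hence for
every n there is a linear G with f G = e^3 modulo varpi^n ([approx_section]).

It remains to make this congruence exact.  A varpi-torsion element of M is
killed by every such G, since V^m has no torsion, so it is killed by e^3 because
M is separated.  Therefore the error of the congruence modulo varpi, multiplied
by e^3, is varpi psi for a linear endomorphism psi of M, and
f (e^3 G) = e^6 + varpi psi.  Writing varpi = tau e^6, the Neumann series
e^3 G (1 - tau psi + tau^2 psi^2 - ...) converges because tau^2 is a multiple of
varpi, and its image under f is e^6 ([neumann_section], [exact_section]).
Lifting V^m -> M to V[M] turns this into the required section. *)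

(** * Free modules *)

Lemma linear_exists (R : pzRingType) (U W : lmodType R) (f : U -> W) :
  linear f -> exists F : {linear U -> W}, F =1 f.
Proof.
move=> lf.
pose F : {linear U -> W} :=
  HB.pack_for {linear U -> W} f (GRing.isLinear.Build R U W *:%R f lf).
by exists F.
Qed.

Section Free.
Variables (R : pzRingType) (X : choiceType) (N : lmodType R).

Lemma supp_finite (c : free_module R X) : finite_set [set x | val c x != 0].
Proof. by have /asboolP := valP c. Qed.

Fact basis_subproof (x : X) : (fun y => (y == x)%:R : R^o) \in @fin_supp R X.
Proof.
apply/asboolP; apply: (@sub_finite_set _ _ [set x]) => // y /=.
by case: (y =P x) => //=; rewrite eqxx.
Qed.
Definition basis (x : X) : free_module R X :=
  exist (fun c => c \in @fin_supp R X) _ (basis_subproof x).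

(** [counit] is the case where [X] is the module [N] and [l] the identity. *)
Definition free_ext (l : X -> N) (c : free_module R X) : N :=
  \sum_(x \in [set: X]) (val c x : R) *: l x.

Lemma free_extE (l : X -> N) (D : set X) (c : free_module R X) :
    finite_set D -> [set x | val c x != 0] `<=` D ->
  free_ext l c = \sum_(x <- fset_set D) (val c x : R) *: l x.
Proof.
move=> finD suppD; rewrite -fsbig_finite // /free_ext.
apply/esym/fsbig_widen => // x [_ /= xD]; have [->|cx] := eqVneq (val c x) 0.
  by rewrite scale0r.
by case: xD; apply: suppD.
Qed.

Fact free_ext_linear l : linear (free_ext l).
Proof.
move=> a u v.
set D := [set x | val u x != 0] `|` [set x | val v x != 0].
have finD : finite_set D by rewrite finite_setU; split; apply: supp_finite.
rewrite !(free_extE l finD); last 3 first.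
- by move=> x; right.
- by move=> x; left.
- move=> x /=; apply: contraNP => /not_orP[/negP/negPn/eqP ux /negP/negPn/eqP vx].
  by rewrite -[(_ + _) x]/(a * val u x + val v x) ux vx mulr0 addr0.
rewrite scaler_sumr -big_split /=; apply: eq_bigr => x _.
by rewrite scalerA -scalerDl.
Qed.
HB.instance Definition _ l := GRing.isLinear.Build R (free_module R X) N *:%R
  (free_ext l) (free_ext_linear l).

Lemma free_ext_basis l x : free_ext l (basis x) = l x.
Proof.
rewrite (@free_extE l [set x]) ?fset_set1 ?big_seq_fset1 /= ?eqxx ?scale1r //.
by move=> y /=; case: (y =P x) => //=; rewrite eqxx.
Qed.
End Free.

Lemma counit_basis (R : pzRingType) (N : lmodType R) (x : N) :
  counit (basis R x) = x.
Proof. exact: (free_ext_basis id). Qed.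

Lemma basis_decomp (R : pzRingType) (X : choiceType) (c : free_module R X) :
  free_ext (@basis R X) c = c.
Proof.
rewrite (free_extE _ (supp_finite c)) //; apply: val_inj.
rewrite raddf_sum /=; apply/funext => y.
rewrite (_ : (\sum_(x <- _) _) y =
   \sum_(x <- fset_set [set x | val c x != 0]) (val c x : R) * (y == x)%:R);
  last by rewrite fct_sumE.
have finc := supp_finite c.
have [/eqP cy|cy] := boolP (val c y == 0).
  rewrite cy big1 // => x _; case: eqP => [<-|_]; last by rewrite mulr0.
  by rewrite cy mul0r.
rewrite (bigD1_seq y) /=; [|by rewrite in_fset_set // inE|exact: fset_uniq].
rewrite eqxx mulr1 big1 ?addr0 // => x; rewrite eq_sym => /negPf ->.
by rewrite mulr0.
Qed.

Lemma linear_basis (R : pzRingType) (X : choiceType) (N : lmodType R)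
  (g : {linear free_module R X -> N}) c : g c = free_ext (g \o @basis R X) c.
Proof.
rewrite -[in LHS](basis_decomp c) !(free_extE _ (supp_finite c)) // linear_sum.
apply: eq_bigr => x _. by rewrite linearZ.
Qed.

(** Free modules are projective: choose a preimage of the image of each basis
element. *)
Lemma free_lift (R : pzRingType) (X : choiceType) (N : lmodType R)
    (g : {linear free_module R X -> N}) :
  exists g' : {linear free_module R X -> free_module R N},
    forall u, counit (g' u) = g u.
Proof.
pose l x := basis R (g (basis R x)).
exists (free_ext l) => u; change (counit (free_ext l u) = g u).
rewrite [RHS]linear_basis !(free_extE _ (supp_finite u)) // linear_sum.
by apply: eq_bigr => x _; rewrite linearZ /= counit_basis.
Qed.

(** * Extension groups and sections *)

Lemma sub_sub_exchange (U : zmodType) (x y x1 y1 x2 y2 : U) :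
  x - y - ((x1 - y1) + (x2 - y2)) = (x - (x1 + x2)) - (y - (y1 + y2)).
Proof.
rewrite [_ - y1 + _]addrACA -[- y1 - y2]opprD [in LHS]opprB [in RHS]opprB.
by rewrite [in LHS](addrC (y1 + y2)) [LHS]addrACA [in LHS](addrC (- y)).
Qed.

Definition has_section (R : pzRingType) (a : R) (N : lmodType R) : Prop :=
  exists s : {linear N -> free_module R N}, forall x, counit (s x) = a *: x.

Section ExtSection.
Variable R : comPzRingType.
Implicit Types (a : R) (M N : lmodType R).

Fact hom_of_subproof M N (f : {linear M -> N}) :
  (f : M -> N) \in @linear_pred R M N.
Proof. by apply/asboolP; exact: linearP. Qed.
Definition hom_of M N (f : {linear M -> N}) : hom_mod M N :=
  exist (fun g => g \in @linear_pred R M N) _ (hom_of_subproof f).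

Fact ker_of_subproof M N (f : {linear M -> N}) x : f x = 0 -> x \in ker_pred f.
Proof. by move=> fx0; apply/eqP. Qed.
Definition ker_of M N (f : {linear M -> N}) x (fx0 : f x = 0) : ker_mod f :=
  exist (fun y => y \in ker_pred f) x (ker_of_subproof fx0).

Lemma counit_val0 N (z : syzygy N 1) : counit (val z : free_module R N) = 0.
Proof. exact: ker_val0. Qed.

(** The map [u |-> a *: u - q u] takes values above [a *: counit u] and vanishes
on the kernel of [counit], so it factors through [N]. *)
Lemma section_of_retraction a N
    (q : {linear free_module R N -> free_module R N}) :
  (forall u, counit (q u) = 0) -> (forall u, counit u = 0 -> q u = a *: u) ->
  has_section a N.
Proof.
move=> qker qid.
have tlin : linear (fun x : N => a *: basis R x - q (basis R x)).
  move=> b x y; apply/eqP; rewrite -subr_eq0; apply/eqP.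
  set w := basis R (b *: x + y); set u := basis R x; set v := basis R y.
  have w0 : counit (w - (b *: u + v)) = 0.
    by rewrite linearB linearP /= !counit_basis subrr.
  have := qid _ w0; rewrite linearB linearP scalerBr scalerDr => E.
  rewrite scalerBr sub_sub_exchange E.
  by rewrite !scalerA [b * a]mulrC subrr.
have [t tE] := linear_exists tlin.
by exists t => x; rewrite tE linearB linearZ /= counit_basis qker subr0.
Qed.

(** The canonical surjection of the second free module onto the first syzygy is
a cocycle.  If [a] times its class vanishes, then multiplication by [a] on the
syzygy extends to the free module on [N], which is what
[section_of_retraction] needs. *)
Lemma ext1_section a N :
  (forall e : Ext 1 N (syzygy N 1), a *: e = 0) -> has_section a N.
Proof.
move=> killed.
pose f : hom_mod (resolution N 1) (syzygy N 1) :=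
  hom_of (@counit R (syzygy N 1)).
have f0 : ext_diff N (syzygy N 1) 1 f = 0.
  apply/val_inj/funext => u.
  exact: (ker_val0 (counit u : ker_mod (@counit R (ker_mod (@counit R N))))).
have := killed (to_quot _ (ker_of f0)).
rewrite -linearZ -(linear0 (to_quot _)) => kE; have := introT (to_quotP _ _ _) kE.
rewrite subr0 => mem.
have [r rE] : exists r, val (a *: ker_of f0) = ext_diff N (syzygy N 1) 0 r
  := asboolW mem.
have rE' (z : syzygy N 1) : val r (val z) = a *: z.
  have := congr1 (fun g : hom_mod _ _ => val g (basis R z)) rE.
  rewrite /= /resolution_diff /= counit_basis => <-.
  by rewrite -[LHS]/(a *: counit (basis R z)) counit_basis.
have qlin : linear (fun u : free_module R N => val (val r u)).
  have /asboolP rlin := valP r.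
  by move=> b u v; rewrite rlin.
have [q qE] := linear_exists qlin.
apply: (section_of_retraction (q := q)) => u; rewrite qE.
  exact: counit_val0.
by move=> u0; exact: (congr1 val (rE' (ker_of u0))).
Qed.

(** Given an [a]-section [s], the map [u |-> a *: u - s (counit u)] sends the
free module to the syzygy and is multiplication by [a] there.  Lifting it to the
next free module gives an [a]-section of the syzygy. *)
Lemma section_syzygy a N : has_section a N -> has_section a (syzygy N 1) /\
  exists r : {linear free_module R N -> syzygy N 1},
    forall z : syzygy N 1, r (val z) = a *: z.
Proof.
move=> [s sE].
have rP u : counit (a *: u - s (counit u)) = 0.
  by rewrite linearB linearZ /= sE subrr.
pose r u : syzygy N 1 := ker_of (rP u).
have vrlin : linear (fun u => a *: u - s (counit u)).
  move=> b u v; rewrite scalerDr [counit _]linearP [s _]linearP scalerBr !scalerA.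
  by rewrite [a * b]mulrC opprD addrACA.
have rlin : linear r by move=> b u v; apply: val_inj; exact: vrlin.
have [r' r'E] := linear_exists rlin.
have r'val (z : syzygy N 1) : r' (val z) = a *: z.
  apply: val_inj; rewrite r'E /= (counit_val0 z) linear0 subr0.
  by [].
split; last by exists r'.
have [g gE] := free_lift r'.
have tlin : linear (fun z : syzygy N 1 => g (val z)).
  by move=> b x y; rewrite !linearP.
have [t tE] := linear_exists tlin.
by exists t => z; rewrite tE gE r'val.
Qed.

Lemma section_syzygy_iter a N n : has_section a N -> has_section a (syzygy N n).
Proof. by move=> h; elim: n => //= n /section_syzygy[]. Qed.

(** A cocycle is a map from a free module that factors through a syzygy [Z];
composing it with the map [r] of [section_syzygy], which is multiplication by
[a] on [Z], shows that [a] times it is a coboundary. *)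
Lemma section_ext a M N i (e : Ext i.+1 M N) :
  has_section a M -> a *: e = 0.
Proof.
move=> /(section_syzygy_iter i)/section_syzygy[_ [r rE]].
rewrite -(to_quotK e); set z := repr e; rewrite -linearZ -(linear0 (to_quot _)).
apply/to_quotP; rewrite subr0; apply/asboolP.
have /asboolP flin := valP (val z).
have [f fE] := linear_exists flin.
have f0 u : f (resolution_diff u) = 0.
  rewrite fE.
  exact: (congr1 (fun g : hom_mod _ _ => val g u) (ker_val0 z)).
have fcounit u : counit u = 0 -> f u = 0.
  move=> u0; rewrite -(f0 (basis R (ker_of u0))).
  exact: (congr1 (fun w => f (val w)) (esym (counit_basis (ker_of u0)))).
have feq u v : counit u = counit v -> f u = f v.
  move=> uv; apply/eqP; rewrite -subr_eq0 -linearB; apply/eqP/fcounit.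
  by rewrite linearB /= uv subrr.
have hlin : linear (fun v => f (basis R (r v))).
  move=> b u v; have rP : r (b *: u + v) = b *: r u + r v by exact: linearP.
  by rewrite -linearP; apply: feq; rewrite rP linearP /= !counit_basis.
have [h hE] := linear_exists hlin.
have hdiff u : a *: val (val z) u = h (resolution_diff u).
  have rdE : r (resolution_diff u) = a *: counit u := rE (counit u).
  by rewrite hE rdE -fE -linearZ; apply: feq; rewrite counit_basis linearZ.
exists (hom_of h).
have hE' : a *: val z = ext_diff M N i (hom_of h).
  apply: val_inj.
  apply/funext => u.
  exact: hdiff.
exact: hE'.
Qed.
End ExtSection.

(** * Congruences and maps that are linear modulo an element *)

Section Congruence.
Variable V : comPzRingType.
Implicit Types (A B : lmodType V) (c d : V).

Definition cong c A (x y : A) := exists z, x - y = c *: z.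

Lemma congP c A (x y : A) :
  to_red_mod c x = to_red_mod c y <-> cong c x y.
Proof. by split=> [/to_quotP/im_scaleP|/im_scaleP/to_quotP]. Qed.

Lemma cong_refl c A (x : A) : cong c x x.
Proof. by exists 0; rewrite subrr scaler0. Qed.

Lemma cong_sym c A (x y : A) : cong c x y -> cong c y x.
Proof. by move=> [z E]; exists (- z); rewrite -opprB E scalerN. Qed.

Lemma cong_trans c A (x y z : A) : cong c x y -> cong c y z -> cong c x z.
Proof.
by move=> [u E] [v F]; exists (u + v); rewrite scalerDr -E -F addrA subrK.
Qed.

Lemma congD c A (x y x' y' : A) :
  cong c x y -> cong c x' y' -> cong c (x + x') (y + y').
Proof.
by move=> [u E] [v F]; exists (u + v); rewrite scalerDr -E -F opprD addrACA.
Qed.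

Lemma congZ c A (x y : A) a : cong c x y -> cong c (a *: x) (a *: y).
Proof.
by move=> [u E]; exists (a *: u); rewrite scalerA mulrC -scalerA -E scalerBr.
Qed.

Lemma cong_lin c A B (f : {linear A -> B}) (x y : A) :
  cong c x y -> cong c (f x) (f y).
Proof. by move=> [u E]; exists (f u); rewrite -linearB E linearZ. Qed.

Lemma cong_dvd c d A (x y : A) : cong (c * d) x y -> cong c x y.
Proof. by move=> [u E]; exists (d *: u); rewrite scalerA. Qed.

Lemma cong_scale c A (x : A) : cong c (c *: x) 0.
Proof. by exists x; rewrite subr0. Qed.

Lemma cong_mull c d A (x y : A) : cong c x y -> cong (d * c) (d *: x) (d *: y).
Proof. by move=> [u E]; exists u; rewrite -scalerBr E scalerA. Qed.

Lemma cong_mod_scale c A (r r' : V) (x : A) :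
  to_red_ring c r = to_red_ring c r' -> cong c (r *: x) (r' *: x).
Proof.
move=> /to_quotP/im_scaleP[z E]; exists (z *: x).
by rewrite -scalerBl E scalerA.
Qed.

(** Such maps stand for linear maps into [B / c B]; working with representatives
avoids comparing modules over the different rings [V / c V]. *)
Definition lin_mod c A B (f : A -> B) :=
  forall a x y, cong c (f (a *: x + y)) (a *: f x + f y).

Lemma lin_mod_dvd c d A B (f : A -> B) : lin_mod (c * d) f -> lin_mod c f.
Proof. by move=> h a x y; exact: cong_dvd (h a x y). Qed.

Section LinMod.
Variables (c : V) (A B : lmodType V) (f : A -> B).
Hypothesis flin : lin_mod c f.

Lemma lin_mod0 : cong c (f 0) 0.
Proof.
have [z] := flin 1 0 0; rewrite !scale1r addr0 opprD addrA subrr sub0r => E.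
by exists (- z); rewrite subr0 scalerN -E opprK.
Qed.

Lemma lin_mod_scale a x : cong c (f (a *: x)) (a *: f x).
Proof.
have := flin a x 0; rewrite addr0 => /cong_trans; apply.
by have := congD (cong_refl c (a *: f x)) lin_mod0; rewrite addr0.
Qed.

Lemma lin_mod_cong x y : cong c x y -> cong c (f x) (f y).
Proof.
move=> [z E]; have {1}-> : x = c *: z + y by rewrite -E subrK.
apply: cong_trans (flin c z y) _.
by have := congD (cong_scale c (f z)) (cong_refl c (f y)); rewrite add0r.
Qed.

Lemma lin_mod_sum (s : seq (V * A)) :
  cong c (f (\sum_(t <- s) t.1 *: t.2)) (\sum_(t <- s) t.1 *: f t.2).
Proof.
elim: s => [|t s IHs]; first by rewrite !big_nil; exact: lin_mod0.
rewrite !big_cons; apply: cong_trans (flin _ _ _) _.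
exact: congD (cong_refl _ _) IHs.
Qed.

Lemma lin_mod_comp_scale a : lin_mod (a * c) (fun x => a *: f x).
Proof.
move=> b x y; have := cong_mull a (flin b x y).
by rewrite scalerDr !scalerA [a * b]mulrC.
Qed.
End LinMod.

Lemma cong_sum c A (I : Type) (s : seq I) (F G : I -> A) :
  (forall i, cong c (F i) (G i)) -> cong c (\sum_(i <- s) F i) (\sum_(i <- s) G i).
Proof.
move=> h; elim/big_ind2: _ => //; first exact: cong_refl.
by move=> *; exact: congD.
Qed.

Lemma to_red_modZ c a A (x : A) :
  to_red_mod c (a *: x) = to_red_ring c a *: to_red_mod c x.
Proof. by rewrite -red_mod_scaleE. Qed.

(** Projectivity of [M / c M] up to [a], in elementary terms: an arbitrary map [l]
can be replaced by one that is linear modulo [c] and whose value at [x] is a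
combination of values of [l], with the same combination of the arguments being
[a *: x] modulo [c].  It is obtained by writing the section of [M / c M] in
coordinates and lifting the coefficients to [V]. *)
Lemma section_mod_lift c a (M A : lmodType V) (l : M -> A) :
    has_section (to_red_ring c a) (red_mod c M) ->
  exists2 g : M -> A, lin_mod c g &
    forall x, exists s : seq (V * M),
      g x = \sum_(t <- s) t.1 *: l t.2 /\
      cong c (\sum_(t <- s) t.1 *: t.2) (a *: x).
Proof.
move=> [s sE].
(* The representative of 0 has to be 0, so that sums may be extended beyond the
   support. *)
pose rho (q : red_ring c) : V := if q == 0 then 0 else repr q.
have rhoK q : to_red_ring c (rho q) = q.
  by rewrite /rho; case: eqP => [->|_]; [rewrite rmorph0|exact: to_red_ringK].
pose S x := [set y | val (s (to_red_mod c x)) y != 0].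
have Sfin x : finite_set (S x) by exact: supp_finite.
pose coef x y : V := rho (val (s (to_red_mod c x)) y).
pose g x : A := \sum_(y <- fset_set (S x)) coef x y *: l (repr y).
have gE x D : finite_set D -> S x `<=` D ->
    g x = \sum_(y <- fset_set D) coef x y *: l (repr y).
  move=> Dfin SD; rewrite /g -!fsbig_finite //.
  apply: fsbig_widen => // y [_ /= yS]; rewrite /coef /rho.
  by case: ifP => [_|/negbT yn]; [rewrite scale0r|case: yS].
exists g => [b x y|x].
  have sP : s (to_red_mod c (b *: x + y)) =
      to_red_ring c b *: s (to_red_mod c x) + s (to_red_mod c y).
    by rewrite to_red_modD to_red_modZ linearP.
  pose D := S x `|` S y `|` S (b *: x + y).
  have finD : finite_set D by rewrite !finite_setU.
  rewrite (gE x D) //; last by move=> z; left; left.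
  rewrite (gE y D) //; last by move=> z; left; right.
  rewrite (gE (b *: x + y) D) //; last by move=> z; right.
  rewrite scaler_sumr -big_split /=; apply: cong_sum => z.
  rewrite scalerA -scalerDl; apply: cong_mod_scale.
  by rewrite rmorphD rmorphM /coef /= !rhoK sP.
exists [seq (coef x y, repr y) | y <- fset_set (S x)]; rewrite !big_map; split=> //.
apply/congP; rewrite to_red_modZ -sE.
rewrite (counitE (Sfin x)) // /to_red_mod linear_sum /=.
apply: eq_bigr => y _; rewrite -[to_quot _ _]/(to_red_mod c _).
by rewrite to_red_modZ rhoK to_red_modK.
Qed.
End Congruence.

(** * Adic limits *)

Section Limits.
Variables (V : comPzRingType) (x : V).
Implicit Types A M : lmodType V.

Definition separated A := forall u v : A, (forall n, cong (x ^+ n) u v) -> u = v.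

Definition cauchy_complete A := forall u : nat -> A,
  (forall n, cong (x ^+ n) (u n.+1) (u n)) ->
  exists v, forall n, cong (x ^+ n) v (u n).

Lemma complete_separated A : adically_complete x A -> separated A.
Proof.
move=> /bij_inj inj u v uv; apply: inj; apply: eq_exist.
by apply: functional_extensionality_dep => n; apply/to_quotP/im_scaleP/uv.
Qed.

Lemma complete_cauchy A : adically_complete x A -> cauchy_complete A.
Proof.
move=> [lim _ limK] u uc.
have compat n : adic_trans (adic_proj x n.+1 (u n.+1)) = adic_proj x n (u n).
  by rewrite adic_transE; apply/to_quotP/im_scaleP/uc.
pose q : adic_completion x A :=
  exist (fun q : forall n, adic_quot x A n => forall n, adic_trans (q n.+1) = q n)
    (fun n => adic_proj x n (u n)) compat.
exists (lim q) => n.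
have /(congr1 (fun r : adic_completion x A => proj1_sig r n)) := limK q.
by move=> /to_quotP/im_scaleP.
Qed.

Lemma cong_fun c m (u v : 'I_m -> V^o) :
  (forall i, cong c (u i) (v i)) -> cong c u v.
Proof. by move=> /choice[z zE]; exists z; apply/funext => i; exact: zE. Qed.

Lemma separated_fun m : separated V^o -> separated ('I_m -> V^o).
Proof.
move=> sep u v uv; apply/funext => i; apply: sep => n.
by have [z zE] := uv n; exists (z i); exact: (congr1 (@^~ i) zE).
Qed.

Lemma cauchy_fun m : cauchy_complete V^o -> cauchy_complete ('I_m -> V^o).
Proof.
move=> lim u uc.
have /choice[v vE] i : exists v : V^o, forall n, cong (x ^+ n) v (u n i).
  apply: lim => n; have [z zE] := uc n.
  by exists (z i); exact: (congr1 (@^~ i) zE).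
by exists v => n; apply: cong_fun.
Qed.

Lemma cong_exp n k A (u v : A) : cong (x ^+ (n + k)) u v -> cong (x ^+ n) u v.
Proof. by rewrite exprD; exact: cong_dvd. Qed.

(** The pointwise limit of the [U j] is linear modulo every power of [x], hence
linear since [A] is separated. *)
Lemma linear_limit n M A (U : nat -> M -> A) :
    separated A -> cauchy_complete A ->
    (forall j, lin_mod (x ^+ (n + j)) (U j)) ->
    (forall j y, cong (x ^+ (n + j)) (U j.+1 y) (U j y)) ->
  exists G : {linear M -> A}, forall j y, cong (x ^+ (n + j)) (G y) (U j y).
Proof.
move=> sep lim Ulin Uc.
have /choice[G GE] y : exists v, forall j, cong (x ^+ (n + j)) v (U j y).
  (* The sequence is delayed by n terms, constant at first, since the definition
     of completeness starts with congruences modulo x^0. *)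
  have [|v vE] := lim (fun i => U (i - n)%N y).
    move=> i; have [lt_in|le_ni] := ltnP i n.
      rewrite (_ : i.+1 - n = i - n)%N; first exact: cong_refl.
      by rewrite (eqnP lt_in) (eqnP (ltnW lt_in)).
    by rewrite subSn // -{1}(subnKC le_ni).
  by exists v => j; have := vE (n + j)%N; rewrite addKn.
have Glin : linear G.
  move=> a u v; apply: sep => j.
  apply: (@cong_exp j n); rewrite addnC.
  apply: cong_trans (GE _ j) _; apply: cong_trans (Ulin _ _ _ _) _.
  by apply/cong_sym/congD/GE/congZ/GE.
have [F FE] := linear_exists Glin.
by exists F => j y; rewrite FE.
Qed.

(** The quotient of [phi y] by [x] is defined up to [x]-torsion only; multiplying
it by [e], which kills that torsion, makes it well defined and linear. *)
Lemma divide_linear (e : V) M (N : lmodType V) (phi : {linear M -> N}) :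
    (forall y : N, x *: y = 0 -> e *: y = 0) -> (forall y, cong x (phi y) 0) ->
  exists psi : {linear M -> N}, forall y, e *: phi y = x *: psi y.
Proof.
move=> tors /choice[z zE].
have phiE y : phi y = x *: z y by rewrite -zE subr0.
have lin : linear (fun y => e *: z y).
  move=> a u v; apply/eqP; rewrite -subr_eq0; apply/eqP.
  rewrite scalerA [a * e]mulrC -scalerA -scalerDr -scalerBr; apply: tors.
  rewrite scalerBr scalerDr scalerA [x * a]mulrC -scalerA -!phiE.
  by rewrite linearP subrr.
have [psi psiE] := linear_exists lin.
by exists psi => y; rewrite psiE phiE !scalerA mulrC.
Qed.

(** Here [f \o G = eta \o (1 + tau psi)], and the last factor can be inverted by a
geometric series because [tau] is topologically nilpotent. *)
Lemma neumann_section (eta tau sigma : V) M A (f : {linear A -> M})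
    (G : {linear M -> A}) (psi : {linear M -> M}) :
    separated M -> separated A -> cauchy_complete A ->
    x = tau * eta -> tau ^+ 2 = x * sigma ->
    (forall y, f (G y) = eta *: y + x *: psi y) ->
  exists S : {linear M -> A}, forall y, f (S y) = eta *: y.
Proof.
move=> sepM sepA limA xE tau2 fG.
(* S N is the sum of the (- tau)^i G psi^i for i < N. *)
pose S := fix S N y : A := if N is N'.+1 then G y - tau *: S N' (psi y) else 0.
have Slin N : linear (S N).
  elim: N => [|N IHN] a u v /=; first by rewrite scaler0 addr0.
  rewrite !linearP IHN scalerDr !scalerA [tau * a]mulrC -!scalerA.
  by rewrite opprD addrACA scalerBr.
have fS N y : cong (tau ^+ N) (f (S N y)) (eta *: y).
  elim: N y => [|N IHN] y /=.
    by exists (0 - eta *: y); rewrite linear0 scale1r.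
  rewrite linearB linearZ /= fG; have := cong_mull tau (IHN (psi y)).
  rewrite -exprS scalerA -xE => h.
  have := congD (cong_refl (tau ^+ N.+1) (eta *: y + x *: psi y)) (congZ (-1) h).
  by rewrite !scaleN1r addrK.
have dS N y : cong (tau ^+ N) (S N.+1 y) (S N y).
  elim: N y => [|N IHN] y; first by exists (S 1%N y); rewrite subr0 scale1r.
  have h := congZ (-1) (cong_mull tau (IHN (psi y))).
  by have := congD (cong_refl _ (G y)) h; rewrite !scaleN1r -exprS.
have tau2n n : tau ^+ n.*2 = x ^+ n * sigma ^+ n.
  by rewrite -mul2n exprM tau2 exprMn.
(* Two terms of the series gain one power of x. *)
have [||H HE] := @linear_limit 0 M A (fun j => S j.*2) sepA limA.
- by move=> j a u v; rewrite Slin; exact: cong_refl.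
- move=> j y; apply: (@cong_dvd _ _ (sigma ^+ j)); rewrite -tau2n.
  apply: cong_trans (dS _ _); apply: (@cong_dvd _ _ tau).
  by rewrite -exprSr; exact: dS.
exists H => y; apply: sepM => n; apply: cong_trans (cong_lin f (HE n y)) _.
by apply: (@cong_dvd _ _ (sigma ^+ n)); rewrite -tau2n; exact: fS.
Qed.
End Limits.

(** * Sections over a complete ring with p-power roots *)

Section Main.
Variables (p : nat) (V : comPzRingType) (varpi : V) (rt : nat -> V).
Variable M : lmodType V.
Hypothesis p_gt1 : (1 < p)%N.
Hypotheses (rt0 : rt 0%N = varpi) (rtS : forall n, rt n.+1 ^+ p = rt n).

Lemma rt_pow n k : rt (n + k) ^+ (p ^ k) = rt n.
Proof.
elim: k => [|k IHk]; first by rewrite addn0 expr1.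
by rewrite addnS expnS exprM rtS IHk.
Qed.

Definition root_ideal : set V :=
  \bigcup_(n in [set n | (0 < n)%N]) principal (rt n).

Lemma root_idealM n c : (0 < n)%N -> root_ideal (c * rt n).
Proof. by move=> n0; exists n => //; exists c. Qed.

Lemma root_ideal_rt n : (0 < n)%N -> root_ideal (rt n).
Proof. by move=> n0; rewrite -[rt n]mul1r; exact: root_idealM. Qed.

Hypothesis sections : forall n a, (0 < n)%N -> root_ideal a ->
  has_section (to_red_ring (varpi ^+ n) a) (red_mod (varpi ^+ n) M).

Section Lifting.
Variable A : lmodType V.
Hypotheses (sepA : separated varpi A) (limA : cauchy_complete varpi A).

Lemma lift_step n a (h : M -> A) :
    root_ideal a -> lin_mod (varpi ^+ n) h ->
  exists g : M -> A, lin_mod (varpi ^+ n.+1) g /\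
    forall x, cong (varpi ^+ n) (g x) (a *: h x).
Proof.
move=> Ia hlin.
have [g glin gE] := section_mod_lift h (sections (ltn0Sn n) Ia).
exists g; split=> // x; have [s [-> sE]] := gE x.
apply: cong_trans (cong_sym (lin_mod_sum hlin s)) _.
apply: cong_trans (lin_mod_scale hlin a x); apply: lin_mod_cong => //.
by apply: (@cong_dvd _ _ varpi); rewrite -exprSr; exact: sE.
Qed.

(** Lifting from modulo [varpi ^+ (n + j)] to the next power costs
[rt (K + j).+1 ^+ p.-1], the quotient of [rt (K + j)] by [rt (K + j).+1].  Hence
the successive lifts multiplied by [rt (K + j)] are compatible, and the total
cost is [rt K]. *)
Lemma lift_limit K n (h : M -> A) :
    lin_mod (varpi ^+ n) h ->
  exists G : {linear M -> A}, forall x, cong (varpi ^+ n) (G x) (rt K *: h x).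
Proof.
move=> hlin.
pose a j := rt (K + j).+1 ^+ p.-1.
have Ia j : root_ideal (a j).
  rewrite /a -(ltn_predK (_ : (0 < p.-1)%N)) ?ltn_predRL //.
  by rewrite exprSr; exact: root_idealM.
have /choice[F FE] (t : nat * (M -> A)) : exists g : M -> A,
    lin_mod (varpi ^+ (n + t.1)) t.2 -> lin_mod (varpi ^+ (n + t.1).+1) g /\
    forall x, cong (varpi ^+ (n + t.1)) (g x) (a t.1 *: t.2 x).
  have [tlin|ntlin] := pselect (lin_mod (varpi ^+ (n + t.1)) t.2).
    by have [g gE] := lift_step (Ia t.1) tlin; exists g.
  by exists (fun _ => 0) => /ntlin.
pose hs := fix hs j := if j is j'.+1 then F (j', hs j') else h.
have hslin j : lin_mod (varpi ^+ (n + j)) (hs j).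
  elim: j => [|j IHj]; first by rewrite addn0.
  by rewrite addnS; exact: (FE (j, hs j) IHj).1.
have [||G GE] := @linear_limit _ varpi n M A (fun j x => rt (K + j) *: hs j x)
   sepA limA.
- move=> j; apply: (@lin_mod_dvd _ _ (rt (K + j))); rewrite mulrC.
  exact: lin_mod_comp_scale.
- move=> j x /=; rewrite addnS -(rtS (K + j)) -(prednK (ltnW p_gt1)) exprS.
  by rewrite -scalerA; apply: congZ; exact: (FE (j, hs j) (hslin j)).2.
by exists G => x; have := GE 0%N x; rewrite !addn0.
Qed.

(** One factor [rt K] for the cokernel of [f], one for the section of
[M / varpi ^+ n], and one for the passage to the limit. *)
Lemma approx_section K (f : {linear A -> M}) n :
    (0 < K)%N -> (forall x, exists v, rt K *: x = f v) -> (0 < n)%N ->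
  exists G : {linear M -> A}, forall x,
    cong (varpi ^+ n) (f (G x)) (rt K ^+ 3 *: x).
Proof.
move=> K0 /choice[l lE] n0.
have [g glin gE] := section_mod_lift l (sections n0 (root_ideal_rt K0)).
have [G GE] := lift_limit K glin.
exists G => x; apply: cong_trans (cong_lin f (GE x)) _.
rewrite linearZ /= exprS -scalerA; apply: congZ; have [s [-> sE]] := gE x.
rewrite linear_sum expr2 -scalerA /=.
rewrite (eq_bigr (fun t => rt K *: (t.1 *: t.2))).
  by rewrite -scaler_sumr; exact: congZ.
by move=> t _; rewrite linearZ /= -lE !scalerA mulrC.
Qed.

(** The exponent 6 is twice that of [approx_section], because the error term is
divided by [varpi] at the cost of [rt K ^+ 3].  The bound on [K] ensures
[12 <= p ^ K], so that [varpi / rt K ^+ 6] has its square in [(varpi)]. *)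
Lemma exact_section K (f : {linear A -> M}) :
    (forall v : A, varpi *: v = 0 -> v = 0) -> separated varpi M ->
    (3 < K)%N -> (forall x, exists v, rt K *: x = f v) ->
  exists S : {linear M -> A}, forall x, f (S x) = rt K ^+ 6 *: x.
Proof.
move=> regA sepM K3 fE; have K0 : (0 < K)%N by exact: leq_trans K3.
have app := approx_section K0 fE.
(* A torsion element is killed by each G, as A has no torsion. *)
have tors (y : M) : varpi *: y = 0 -> rt K ^+ 3 *: y = 0.
  move=> y0; apply: sepM => n; have [G GE] := app n.+1 isT.
  have Gy : G y = 0 by apply: regA; rewrite -linearZ y0 linear0.
  have := GE y; rewrite Gy linear0 => /cong_sym h.
  by apply: (@cong_dvd _ _ varpi); rewrite -exprSr; exact: h.
have [G GE] := app 1%N isT.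
have philin : linear (fun x => f (G x) - rt K ^+ 3 *: x).
  move=> b u v; rewrite [G _]linearP [f _]linearP scalerBr scalerDr !scalerA.
  by rewrite [_ * b]mulrC opprD addrACA.
have [phi phiE] := linear_exists philin.
have [|psi psiE] := divide_linear (phi := phi) tors.
  by move=> y; have [z zE] := GE y; exists z; rewrite subr0 phiE zE expr1.
have Glin : linear (fun x => rt K ^+ 3 *: G x).
  by move=> b u v; rewrite [G _]linearP scalerDr !scalerA [_ * b]mulrC.
have [G' G'E] := linear_exists Glin.
pose P := (p ^ K)%N.
have P12 : (12 <= P)%N.
  apply: (@leq_trans (2 ^ 4)) => //.
  by apply: (@leq_trans (p ^ 4)); rewrite ?leq_exp2r ?leq_pexp2l // ltnW.
have rtP : varpi = rt K ^+ P by rewrite -rt0 -(rt_pow 0 K).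
apply: (@neumann_section _ varpi _ (rt K ^+ (P - 6))
  (rt K ^+ (2 * (P - 6) - P)) _ _ f G' psi) => //.
- by rewrite -exprD subnK // (leq_trans _ P12).
- by rewrite rtP -exprM -exprD; congr (_ ^+ _); lia.
- move=> y; rewrite G'E linearZ /= -psiE phiE scalerBr scalerA -exprD.
  by rewrite addrC subrK.
Qed.
End Lifting.
End Main.

(** * Almost projectivity *)

Lemma almost_fin_gen_generators (V : comPzRingType) (I : set V)
    (M : lmodType V) (a : V) :
    almost_fin_gen (idfun : {rmorphism V -> V}) I M -> principal a `<=` I ->
  exists m (e : 'I_m -> M), forall x, exists c : 'I_m -> V,
    a *: x = \sum_i c i *: e i.
Proof.
move=> fg aI.
have spanI : lin_span (fun _ : 'I_1 => a : V^o) `<=` (I : set V^o).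
  by move=> _ [c ->]; apply: aI; exists (c ord0); rewrite big_ord1.
have [M0 [f0 [[m [g gE]] _ cok]]] := fg 1%N _ spanI.
exists m, (fun i => f0 (g i)) => x.
have aspan : lin_span (fun _ : 'I_1 => a : V^o) a.
  by exists (fun=> 1); rewrite big_ord1 scale1r.
have := cok a (to_quot _ x) aspan.
rewrite -linearZ -(linear0 (to_quot _)) => /to_quotP; rewrite subr0.
move=> /asboolP[m0 ->]; have [c ->] : lin_span g m0 by rewrite gE.
by exists c; rewrite linear_sum; apply: eq_bigr => i _; rewrite linearZ.
Qed.

Theorem proposition4p8 (p : nat) (V : comPzRingType) (varpi : V) (rt : nat -> V)
    (M : lmodType V) :
  let I : set V := \bigcup_(n in [set n | (0 < n)%N]) principal (rt n) in
  prime p ->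
  GRing.lreg varpi ->
  rt 0%N = varpi ->
  (forall n, rt n.+1 ^+ p = rt n) ->
  almost_fin_gen (idfun : {rmorphism V -> V}) I M ->
  (forall n, (0 < n)%N ->
     almost_projective (to_red_ring (varpi ^+ n)) I (red_mod (varpi ^+ n) M)) ->
  adically_complete varpi M ->
  adically_complete varpi V^o ->
  almost_projective (idfun : {rmorphism V -> V}) I M.
Proof.
move=> I p_prime reg rt0 rtS fg proj complM complV N [//|i] _ a e [k _ [b ->]].
have p_gt1 := prime_gt1 p_prime.
suff sec : has_section (rt k) M.
  have e0 : rt k *: e = 0 := section_ext e sec.
  exact: etrans (esym (scalerA b (rt k) e)) (etrans (congr1 _ e0) (scaler0 _ b)).
(* Four steps further, p^4 >= 6 gives rt k as a multiple of rt K ^+ 6, and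
   p^K >= 12. *)
pose K := (k + 4)%N.
have K3 : (3 < K)%N by rewrite leq_addl.
have KI : principal (rt K) `<=` I by move=> c cK; exists K => //=; exact: leq_trans K3.
have [m [g gE]] := almost_fin_gen_generators fg KI.
have flin : linear (fun v : 'I_m -> V^o => \sum_i (v i : V) *: g i).
  move=> c u v; rewrite scaler_sumr -big_split /=; apply: eq_bigr => j _.
  by rewrite scalerA -scalerDl.
have [f fE] := linear_exists flin.
have fsurj x : exists v, rt K *: x = f v.
  by have [c cE] := gE x; exists c; rewrite fE cE.
have sections n c : (0 < n)%N -> I c ->
    has_section (to_red_ring (varpi ^+ n) c) (red_mod (varpi ^+ n) M).
  by move=> n0 Ic; apply: ext1_section => e'; exact: (proj n n0 _ 1%N).
have regA (v : 'I_m -> V^o) : varpi *: v = 0 -> v = 0.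
  move=> v0; apply/funext => j; apply: reg; rewrite mulr0.
  exact: (congr1 (@^~ j) v0).
have [S SE] := exact_section p_gt1 rt0 rtS sections
  (separated_fun (complete_separated complV)) (cauchy_fun (complete_cauchy complV))
  regA (complete_separated complM) K3 fsurj.
pose d := rt K ^+ (p ^ 4 - 6).
have Tlin : linear (fun x => d *: \sum_i (S x i : V) *: basis V (g i)).
  move=> c x y; rewrite [S _]linearP [c *: (d *: _)]scalerA [c * d]mulrC -scalerA.
  rewrite -scalerDr; congr (_ *: _); rewrite scaler_sumr -big_split /=.
  by apply: eq_bigr => j _; rewrite scalerA -scalerDl.
have [T TE] := linear_exists Tlin.
have p46 : (6 <= p ^ 4)%N.
  by apply: (@leq_trans (2 ^ 4)) => //; rewrite leq_exp2r.
exists T => x; rewrite TE linearZ linear_sum /=.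
rewrite (eq_bigr (fun j => (S x j : V) *: g j)) => [|j _].
  by rewrite -fE SE scalerA -exprD subnK // rt_pow.
by rewrite linearZ /= counit_basis.
Qed.
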